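(* For every integer $n\ge 2$, $$\overline{\mathrm{dist}}_T(\mathcal{SDD}_n^*,\mathcal{S}^n_+)=\frac{n-2}{n}.$$
   Context: Let $\mathbb{S}^n$ be the space of real symmetric $n\times n$ matrices with Frobenius norm $\|X\|_F=\sqrt{\sum_{i,j=1}^n X_{i,j}^2}$, and let $\mathcal{S}^n_+=\{X\in\mathbb{S}^n\mid d^TXd\ge 0 \text{ for all } d\in\mathbb{R}^n\}$ be the positive semidefinite cone. Define $$\mathcal{SDD}_n^*:=\{X\in\mathbb{S}^n\mid X_{i,i}X_{j,j}\ge X_{i,j}^2\ (1\le i<j\le n),\ X_{i,i}\ge 0\ (i=1,\ldots,n)\}.$$ Let $\mathrm{P}_{\mathcal{S}^n_+}(X):=\mathrm{argmin}_{Y\in\mathcal{S}^n_+}\|X-Y\|_F$ be the metric projection of $X$ onto $\mathcal{S}^n_+$, and $\mathrm{Tr}(X)=\sum_{i=1}^n X_{i,i}$. For a set $\mathcal{S}$ with $\mathcal{S}^n_+\subseteq\mathcal{S}\subseteq\mathbb{S}^n$, the trace normalized distance is $$\overline{\mathrm{dist}}_T(\mathcal{S},\mathcal{S}^n_+):=\sup_{X\in\mathcal{S},\ \mathrm{Tr}(X)=1}\|X-\mathrm{P}_{\mathcal{S}^n_+}(X)\|_F.$$ *)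

(* Defs.v *)
From mathcomp Require Import all_boot all_order all_algebra.
From mathcomp Require Import all_classical all_reals all_analysis.

Set Implicit Arguments.
Unset Strict Implicit.
Unset Printing Implicit Defensive.

Import Order.TTheory GRing.Theory Num.Theory.

Local Open Scope classical_set_scope.
Local Open Scope ring_scope.

Section Defs.
Variables (R : realType) (n : nat).
Implicit Types (X Y Z : 'M[R]_n) (S : set 'M[R]_n).

Definition Sym : set 'M[R]_n := [set X | X \is symmetricmx].

Definition frob X : R := Num.sqrt (\sum_(i < n) \sum_(j < n) X i j ^+ 2).

Definition PSD : set 'M[R]_n :=
  [set X | Sym X /\ forall d : 'cV[R]_n, 0 <= (d^T *m X *m d) 0 0].

Definition SDDdual : set 'M[R]_n :=
  [set X | [/\ Sym X,
     forall i j : 'I_n, (i < j)%N -> X i i * X j j >= X i j ^+ 2 &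
     forall i : 'I_n, X i i >= 0]].

Definition argmin_PSD X : set 'M[R]_n :=
  [set Y | PSD Y /\ forall Z, PSD Z -> frob (X - Y) <= frob (X - Z)].

(* [PSD] is closed and convex, so [argmin_PSD X] is a singleton for symmetric
   [X]; [xget] picks its element, and its default value 0 is never used. *)
Definition proj_PSD X : 'M[R]_n := xget 0 (argmin_PSD X).

(* Meant for [S] with [PSD `<=` S `<=` Sym]. The supremum is taken in the
   extended reals, since the real [sup] is 0 on unbounded sets. *)
Definition dist_tr S : \bar R :=
  ereal_sup [set (frob (X - proj_PSD X))%:E | X in [set X | S X /\ \tr X = 1]].

Lemma SymP X : Sym X <-> (forall i j, X i j = X j i).
Proof.
rewrite /Sym /= qualifE /= expr0 scale1r map_mx_id //; split.
  by move=> /eqP XT i j; rewrite {1}XT mxE.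
by move=> XT; apply/eqP/matrixP => i j; rewrite mxE.
Qed.

End Defs.

(* Main.v *)
Require Import Defs.
From mathcomp Require Import all_boot all_order all_algebra.
From mathcomp Require Import all_classical all_reals all_analysis.
From mathcomp Require Import ring lra.

(** The distance is computed by duality with the cone of positive semidefinite
    matrices, using no spectral theory.

    Upper bound.  If [P] is the projection of a symmetric [X], the residual
    [N = P - X] is itself positive semidefinite and satisfies
    [|N|_F^2 <= - <X, N>] ([argmin_residual]; this is half of Moreau's
    decomposition).  It therefore suffices to show
    [- <X, W> <= (n - 2) / n * |W|_F] for every positive semidefinite [W]
    ([SDDdual_dot_ge]).  Put [u_i = sqrt X_ii], so that [u] is a unit vector
    when the trace is one, and [|X_ij| <= u_i u_j] by the defining 2 x 2 minors.
    With [s = \sum_ij u_i u_j |W_ij|] and [t = \sum_i u_i^2 W_ii] this gives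
    [- <X, W> <= s - 2 t].  Cauchy-Schwarz against the unit matrix [u u^T]
    gives [s <= |W|_F].  Testing [W] on the vectors [u_i e_i +- u_j e_j] gives
    [2 u_i u_j |W_ij| <= u_i^2 W_ii + u_j^2 W_jj], whose sum over all [(i, j)]
    is [s <= n t].  Hence [s - 2 t <= (1 - 2 / n) s <= (n - 2) / n * |W|_F].

    Lower bound.  All these inequalities are equalities for [X = (2 I - J) / n],
    where [J] is the all-ones matrix.  Since [J / n] has norm one, is positive
    semidefinite, and [<X, J / n> = - (n - 2) / n], no positive semidefinite
    matrix is closer to [X] than [(n - 2) / n] ([extremal_dist_ge]).

    Nothing above says that a nearest point exists, and without one
    [proj_PSD X] would just be [0].  Existence ([argmin_PSD_exists]) comes from
    the compactness of the positive semidefinite matrices in a ball. *)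

Import Order.TTheory GRing.Theory Num.Theory.
Import numFieldNormedType.Exports.

Local Open Scope classical_set_scope.
Local Open Scope ring_scope.

(** * The Frobenius inner product and the positive semidefinite cone *)

Section Frobenius.
Context {R : realType} {n : nat}.
Implicit Types (A B C X P W : 'M[R]_n) (d : 'cV[R]_n) (t : R).

Definition mxdot A B : R := \sum_i \sum_j A i j * B i j.

Lemma mxdotC A B : mxdot A B = mxdot B A.
Proof. by apply: eq_bigr => i _; apply: eq_bigr => j _; rewrite mulrC. Qed.

Lemma mxdotDr A B C : mxdot C (A + B) = mxdot C A + mxdot C B.
Proof.
rewrite -big_split; apply: eq_bigr => i _; rewrite -big_split.
by apply: eq_bigr => j _; rewrite mxE mulrDr.
Qed.

Lemma mxdotZr t A C : mxdot C (t *: A) = t * mxdot C A.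
Proof.
rewrite mulr_sumr; apply: eq_bigr => i _; rewrite mulr_sumr.
by apply: eq_bigr => j _; rewrite mxE mulrCA.
Qed.

Lemma mxdotNr A C : mxdot C (- A) = - mxdot C A.
Proof. by rewrite -scaleN1r mxdotZr mulN1r. Qed.

Lemma mxdotBr A B C : mxdot C (A - B) = mxdot C A - mxdot C B.
Proof. by rewrite mxdotDr mxdotNr. Qed.

Lemma mxdotDZl t A B C : mxdot (A + t *: B) C = mxdot A C + t * mxdot B C.
Proof. by rewrite mxdotC mxdotDr mxdotZr !(mxdotC C). Qed.

Lemma mxdot_sqrDZ t A B : mxdot (A + t *: B) (A + t *: B) =
  mxdot A A + 2 * t * mxdot A B + t ^+ 2 * mxdot B B.
Proof. by rewrite mxdotDZl !mxdotDr !mxdotZr (mxdotC B A); ring. Qed.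

Lemma mxdot_ge0 A : 0 <= mxdot A A.
Proof.
by apply: sumr_ge0 => i _; apply: sumr_ge0 => j _; rewrite -expr2 sqr_ge0.
Qed.

Lemma frobE A : frob A = Num.sqrt (mxdot A A).
Proof.
by congr Num.sqrt; apply: eq_bigr => i _; apply: eq_bigr => j _; rewrite expr2.
Qed.

Lemma sqr_frob A : frob A ^+ 2 = mxdot A A.
Proof. by rewrite frobE sqr_sqrtr ?mxdot_ge0. Qed.

Lemma frob_ge0 A : 0 <= frob A.
Proof. exact: sqrtr_ge0. Qed.

Lemma frobN A : frob (- A) = frob A.
Proof.
congr Num.sqrt; apply: eq_bigr => i _; apply: eq_bigr => j _.
by rewrite mxE sqrrN.
Qed.

Lemma le_coord_frob A i j : `|A i j| <= frob A.
Proof.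
rewrite -sqrtr_sqr ler_wsqrtr// (bigD1 i)//= (bigD1 j)//= -addrA lerDl.
rewrite addr_ge0// !sumr_ge0// => k _; rewrite ?sqr_ge0// sumr_ge0// => l _.
exact: sqr_ge0.
Qed.

(** Cauchy-Schwarz.  With [A] of norm one, the squared norm of
    [B - <A, B> A] is [|B|^2 - <A, B>^2], which spares the degenerate case. *)
Lemma mxdot_unit_le_frob A B : mxdot A A = 1 -> mxdot A B <= frob B.
Proof.
move=> A1; have := mxdot_ge0 (B + - mxdot A B *: A).
rewrite mxdot_sqrDZ A1 (mxdotC B A) -sqr_frob => h.
rewrite (le_trans (ler_norm _))// -ler_sqr ?nnegrE ?frob_ge0//.
by rewrite real_normK ?num_real//; lra.
Qed.

Lemma quad_formE A d : (d^T *m A *m d) 0 0 = mxdot A (d *m d^T).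
Proof.
rewrite mxE; under eq_bigr do rewrite mxE mulr_suml.
rewrite exchange_big; apply: eq_bigr => i _; apply: eq_bigr => j _ /=.
by rewrite !mxE big_ord1 !mxE mulrAC mulrC.
Qed.

Lemma PSD_dot A d : PSD A -> 0 <= mxdot A (d *m d^T).
Proof. by case=> _ /(_ d); rewrite quad_formE. Qed.

Lemma PSD_outer d : PSD (d *m d^T).
Proof.
split=> [|e]; first by apply/SymP => i j; rewrite !mxE !big_ord1 !mxE mulrC.
rewrite mulmxA -mulmxA mxE big_ord1.
suff -> : (d^T *m e) 0 0 = (e^T *m d) 0 0 by rewrite -expr2 sqr_ge0.
by rewrite -[in RHS](trmxK d) -trmx_mul [RHS]mxE.
Qed.

Lemma PSD_DZ t A B : 0 <= t -> PSD A -> PSD B -> PSD (A + t *: B).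
Proof.
move=> t0 [/SymP sA pA] [/SymP sB pB]; split=> [|d].
  by apply/SymP => i j; rewrite !mxE sA sB.
by rewrite quad_formE mxdotDZl -!quad_formE addr_ge0// mulr_ge0.
Qed.

Lemma PSD0 : PSD (0 : 'M[R]_n).
Proof.
split=> [|d]; first by apply/SymP => i j; rewrite !mxE.
by rewrite mulmx0 mul0mx mxE.
Qed.

Lemma PSD_diag_ge0 W i : PSD W -> 0 <= W i i.
Proof.
case=> _ /(_ (delta_mx i 0)).
by rewrite trmx_delta -rowE -colE !mxE.
Qed.

Lemma PSD_pair W (a b : R) i j : PSD W ->
  0 <= a ^+ 2 * W i i + 2 * (a * b) * W i j + b ^+ 2 * W j j.
Proof.
case=> /SymP sW /(_ (a *: delta_mx i 0 + b *: delta_mx j 0)).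
rewrite [(_ + _)^T]linearD/= ![(_ *: _)^T]linearZ/= !trmx_delta.
rewrite !mulmxDl !mulmxDr -!scalemxAl -!scalemxAr.
rewrite -!rowE -!colE !mxE (sW j i).
by congr (0 <= _); ring.
Qed.

(** The test vectors [a e_i + b e_j] and [a e_i - b e_j] bound [W i j] from both
    sides.  This form, unlike [W_ij^2 <= W_ii W_jj], can be summed directly. *)
Lemma PSD_pair_norm W (a b : R) i j : PSD W -> 0 <= a -> 0 <= b ->
  2 * (a * b * `|W i j|) <= a ^+ 2 * W i i + b ^+ 2 * W j j.
Proof.
move=> pW a0 b0; have p := PSD_pair W a b i j pW.
have q := PSD_pair W a (- b) i j pW.
by case: (ger0P (W i j)) => _; lra.
Qed.

End Frobenius.

(** * Projecting onto the cone *)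

Section Projection.
Context {R : realType} {n : nat}.
Implicit Types (A B C X P W : 'M[R]_n) (d : 'cV[R]_n) (t : R).

(** The first-order condition at a minimum: with [a = <A, C>] and
    [b = |C|^2], the expression in the hypothesis is [|A + t C|^2 - |A|^2]. *)
Lemma slope_ge0 (a b : R) :
  (forall t, 0 < t -> t <= 1 -> 0 <= 2 * t * a + t ^+ 2 * b) -> 0 <= a.
Proof.
move=> h; rewrite leNgt; apply/negP => a0.
have b1 : 0 < `|b| + `|a| by rewrite ltr_wpDl// normr_gt0 lt_eqF.
(* At this [t], [t b] is at most [|a|], too small to offset [2 a]. *)
have t0 : 0 < `|a| / (`|b| + `|a|) by rewrite divr_gt0// normr_gt0 lt_eqF.
have := h _ t0; rewrite ler_pdivrMr// mul1r lerDr normr_ge0 => /(_ isT).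
set t := `|a| / _ in t0 *.
have -> : 2 * t * a + t ^+ 2 * b = t * (2 * a + t * b) by ring.
rewrite pmulr_rge0//.
have : t * b <= `|a|.
  rewrite (le_trans (ler_wpM2l (ltW t0) (ler_norm b)))//.
  by rewrite mulrAC ler_pdivrMr// ler_wpM2l// lerDl.
by rewrite (ltr0_norm a0); lra.
Qed.

Lemma argmin_slope X P C :
  argmin_PSD X P -> (forall t, 0 < t -> t <= 1 -> PSD (P + t *: C)) ->
  0 <= mxdot (P - X) C.
Proof.
move=> [_ minP] pC; apply: (@slope_ge0 _ (mxdot C C)) => t t0 t1.
have := minP _ (pC t t0 t1).
rewrite -ler_sqr ?nnegrE ?frob_ge0//.
rewrite -(frobN (X - P)) -(frobN (X - _)) !opprB !sqr_frob.
by rewrite addrAC mxdot_sqrDZ -addrA lerDl.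
Qed.

(** Moving from [P] along [d d^T] stays in the cone, so [P - X] has nonnegative
    inner product with [d d^T]: it is positive semidefinite.  Shrinking [P]
    towards [0] also stays in the cone, so [<P - X, P> <= 0], which turns
    [|P - X|^2 = <P - X, P> - <P - X, X>] into the stated inequality. *)
Lemma argmin_residual X P : Sym X -> argmin_PSD X P ->
  PSD (P - X) /\ frob (P - X) ^+ 2 <= - mxdot X (P - X).
Proof.
move=> /SymP sX mP; have [pP _] := mP; have /SymP sP := pP.1; split.
  split=> [|d]; first by apply/SymP => i j; rewrite !mxE sX sP.
  rewrite quad_formE; apply: argmin_slope mP _ => t t0 _.
  by apply: PSD_DZ; [exact: ltW|exact: pP|exact: PSD_outer].
have : 0 <= mxdot (P - X) (- P).
  apply: argmin_slope mP _ => t t0 t1.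
  suff -> : P + t *: - P = 0 + (1 - t) *: P.
    by apply: PSD_DZ; [rewrite subr_ge0|exact: PSD0|].
  by rewrite scalerN add0r scalerBl scale1r.
by rewrite mxdotNr sqr_frob mxdotBr (mxdotC X); lra.
Qed.

(** Matrices are parametrized by row vectors, for which boxes are compact as
    products of segments. *)
Lemma vec_mx_coord_continuous i j :
  continuous (fun v : 'rV[R]_(n * n) => vec_mx v i j).
Proof. by under eq_fun do rewrite mxE; exact: coord_continuous. Qed.

Lemma continuous_sumr (T : topologicalType) (I : finType) (F : I -> T -> R) :
  (forall i, continuous (F i)) -> continuous (fun x => \sum_i F i x).
Proof.
by move=> cF; apply: continuous_big => // -[x y]; exact: add_continuous.
Qed.

Lemma frob_vec_mx_continuous X :
  continuous (fun v : 'rV[R]_(n * n) => frob (X - vec_mx v)).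
Proof.
move=> v; apply: (continuous_comp _ (@sqrt_continuous R _)).
move: v; apply: continuous_sumr => i; apply: continuous_sumr => j.
have cB : continuous (fun w : 'rV[R]_(n * n) => (X - vec_mx w) i j).
  have -> : (fun w : 'rV_(n * n) => (X - vec_mx w) i j) =
            (fun w => X i j - vec_mx w i j) by apply/funext => w; rewrite !mxE.
  move=> w; apply: continuousB; first exact: cst_continuous.
  exact: vec_mx_coord_continuous.
by move=> v; exact: (continuousM (cB v) (cB v)).
Qed.

Lemma mxdot_vec_mx_continuous B :
  continuous (fun v : 'rV[R]_(n * n) => mxdot (vec_mx v) B).
Proof.
apply: continuous_sumr => i; apply: continuous_sumr => j v.
by apply: continuousM; [exact: vec_mx_coord_continuous|exact: cst_continuous].
Qed.

Lemma closed_PSD : closed [set v : 'rV[R]_(n * n) | PSD (vec_mx v)].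
Proof.
have -> : [set v : 'rV[R]_(n * n) | PSD (vec_mx v)] =
    (\bigcap_(p : 'I_n * 'I_n)
        [set v | vec_mx v p.1 p.2 - vec_mx v p.2 p.1 = 0]) `&`
    \bigcap_(d : 'cV[R]_n) [set v | 0 <= mxdot (vec_mx v) (d *m d^T)].
  apply/seteqP; split=> v /=.
    move=> [/SymP s p]; split=> [[i j] _|d _] /=; first by rewrite s subrr.
    by rewrite -quad_formE.
  move=> [s p]; split=> [|d]; last by rewrite quad_formE; exact: p.
  by apply/SymP => i j; apply/eqP; rewrite -subr_eq0; apply/eqP/(s (i, j)).
apply: closedI; apply: closed_bigI => i _.
  apply: (preimage_closed (D := [set x | x = 0]) _ (@closed_eq R 0)) => v _.
  by apply: continuousB; exact: vec_mx_coord_continuous.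
apply: (preimage_closed (f := fun v => mxdot (vec_mx v) (i *m i^T)) _
  (@closed_ge R 0)) => v _.
exact: mxdot_vec_mx_continuous.
Qed.

(** Since [0] is a competitor, only the matrices [Z] with [|X - Z| <= |X|]
    matter; they have entries at most [2 |X|], so they lie in a compact box. *)
Lemma argmin_PSD_exists X : exists P, argmin_PSD X P.
Proof.
pose A := [set v : 'rV[R]_(n * n) | PSD (vec_mx v)] `&`
          [set v | frob (X - vec_mx v) <= frob X].
have A0 : A 0.
  have -> : 0 = mxvec (0 : 'M[R]_n) by rewrite linear0.
  by split; rewrite /= mxvecK ?subr0//; exact: PSD0.
have cA : compact A.
  apply: (@subclosed_compact _ _
    [set v : 'rV[R]_(n * n) | forall k, v ord0 k \in `[- (2 * frob X), 2 * frob X]]).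
  - apply: closedI; first exact: closed_PSD.
    apply: (preimage_closed (f := fun v => frob (X - vec_mx v)) _
      (@closed_le R (frob X))) => v _.
    exact: frob_vec_mx_continuous.
  - apply: (@rV_compact _ _ (fun=> `[- (2 * frob X), 2 * frob X]%classic)).
    by move=> _; exact: segment_compact.
  move=> v [_ /= vX] k; case/mxvec_indexP: k => i j.
  rewrite in_itv/= -ler_norml -[v](vec_mxK) mxvecE.
  have := le_coord_frob (X - vec_mx v) i j; have := le_coord_frob X i j.
  rewrite !mxE !ler_norml; lra.
have [c cA' minc] := compact_EVT_min (ex_intro _ 0 A0) cA
  (continuous_subspaceT (frob_vec_mx_continuous X)).
have [pc cX] := set_mem cA'.
exists (vec_mx c); split=> // Z pZ.
have [ZX|/ltW ZX] := leP (frob (X - Z)) (frob X); last exact: le_trans ZX.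
have := minc (mxvec Z); rewrite mxvecK; apply; rewrite inE /A/= mxvecK.
by split.
Qed.

Lemma proj_PSDP X : argmin_PSD X (proj_PSD X).
Proof. by have [P mP] := argmin_PSD_exists X; exact: (xgetI 0 mP). Qed.

End Projection.

(** * The two bounds *)

Section Bounds.
Context {R : realType} {n : nat} (n_ge2 : (2 <= n)%N).
Implicit Types (X P W : 'M[R]_n).

Let n_gt0 : 0 < n%:R :> R.
Proof. by rewrite ltr0n (ltn_trans _ n_ge2). Qed.

Let ratio_ge0 : 0 <= (n%:R - 2) / n%:R :> R.
Proof. by rewrite divr_ge0 ?ler0n// subr_ge0 ler_nat. Qed.

(** The heart of the upper bound.  Bounding [\sum_ij u_i u_j |W_ij|] by [|W|_F]
    would only give the constant [1]; but the diagonal of [W] carries at least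
    [1 / n] of that sum and enters with the opposite sign, which improves the
    constant to [1 - 2 / n]. *)
Lemma SDDdual_dot_ge X W : SDDdual X -> \tr X = 1 -> PSD W ->
  - mxdot X W <= (n%:R - 2) / n%:R * frob W.
Proof.
move=> [/SymP sX mX dX] trX pW.
pose u i := Num.sqrt (X i i).
have u0 i : 0 <= u i by exact: sqrtr_ge0.
have uE i : u i ^+ 2 = X i i by rewrite sqr_sqrtr.
have u1 : \sum_i u i ^+ 2 = 1 by rewrite -trX; apply: eq_bigr => i _; rewrite uE.
have Xu i j : `|X i j| <= u i * u j.
  rewrite -sqrtrM// -sqrtr_sqr ler_wsqrtr//.
  have [ij|ji|/val_inj->] := ltngtP i j; first exact: mX.
    by rewrite sX mulrC; exact: mX.
  by rewrite expr2.
pose U : 'M[R]_n := \matrix_(i, j) (u i * u j).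
pose V : 'M[R]_n := map_mx Num.norm W.
have UU : mxdot U U = 1.
  rewrite -[RHS]mulr1 -{1}u1 -u1 mulr_suml; apply: eq_bigr => i _.
  rewrite mulr_sumr; apply: eq_bigr => j _; rewrite !mxE; ring.
have UVW : mxdot U V <= frob W.
  have -> : frob W = frob V.
    congr Num.sqrt; apply: eq_bigr => i _; apply: eq_bigr => j _.
    by rewrite mxE real_normK ?num_real.
  exact: mxdot_unit_le_frob.
pose T := \sum_i u i ^+ 2 * W i i.
have UVT : mxdot U V <= n%:R * T.
  have sumT1 : \sum_(i < n) \sum_(j < n) u i ^+ 2 * W i i = n%:R * T.
    rewrite mulr_sumr; apply: eq_bigr => i _.
    by rewrite sumr_const card_ord -[LHS]mulr_natl.
  have sumT2 : \sum_(i < n) \sum_(j < n) u j ^+ 2 * W j j = n%:R * T.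
    by rewrite exchange_big.
  suff : 2 * mxdot U V <= n%:R * T + n%:R * T by lra.
  rewrite -{1}sumT1 -sumT2 -big_split mulr_sumr ler_sum// => i _.
  rewrite mulr_sumr -big_split ler_sum// => j _; rewrite !mxE.
  exact: PSD_pair_norm.
(* On the diagonal [U i i * V i i = X i i * W i i], so the sign of that term
   costs twice the diagonal sum [T]. *)
have XWT : - mxdot X W <= mxdot U V - 2 * T.
  rewrite /mxdot mulr_sumr -sumrN -sumrB ler_sum// => i _.
  rewrite (bigD1 i)//= [in leRHS](bigD1 i)//= !mxE -expr2 uE.
  rewrite ger0_norm ?PSD_diag_ge0// opprD.
  suff : - (\sum_(j | j != i) X i j * W i j) <= \sum_(j | j != i) U i j * V i j.
    by lra.
  rewrite -sumrN ler_sum// => j _; rewrite !mxE.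
  rewrite (le_trans (ler_norm _))// normrN normrM.
  by rewrite ler_wpM2r.
apply: (le_trans XWT); apply: (le_trans _ (ler_wpM2l ratio_ge0 UVW)).
have -> : (n%:R - 2) / n%:R * mxdot U V = mxdot U V - 2 * (mxdot U V / n%:R).
  by field; rewrite gt_eqF.
by rewrite lerD2l lerN2 ler_pM2l// ler_pdivrMr// mulrC.
Qed.

Lemma SDDdual_dist_le X : SDDdual X -> \tr X = 1 ->
  frob (X - proj_PSD X) <= (n%:R - 2) / n%:R.
Proof.
move=> dX trX; have [sX _ _] := dX.
have [pN] := argmin_residual X _ sX (proj_PSDP X).
rewrite -(frobN (X - _)) opprB.
set N := _ - X => hN; have := le_trans hN (SDDdual_dot_ge _ _ dX trX pN).
have [->|N0] := eqVneq (frob N) 0.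
  by rewrite ratio_ge0.
by rewrite expr2 ler_pM2r// lt_neqAle eq_sym N0 frob_ge0.
Qed.

(** [(2 I - J) / n]: every defining 2 x 2 minor vanishes, and the eigenvalue on
    the all-ones vector is as negative as the trace allows. *)
Definition extremal_mx : 'M[R]_n :=
  \matrix_(i, j) ((2 * (i == j)%:R - 1) / n%:R).

Lemma mxtrace_extremal : \tr extremal_mx = 1.
Proof.
rewrite /mxtrace (eq_bigr (fun=> n%:R^-1)); last first.
  by move=> i _; rewrite mxE eqxx mulr1; set c := n%:R^-1; lra.
by rewrite sumr_const card_ord -[LHS]mulr_natl mulfV ?gt_eqF.
Qed.

Lemma SDDdual_extremal : SDDdual extremal_mx.
Proof.
split=> [|i j|i]; first by apply/SymP => i j; rewrite !mxE eq_sym.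
  rewrite ltn_neqAle => /andP[ij _].
  by rewrite !mxE !eqxx -val_eqE (negPf ij) mulr0 mulr1; set c := n%:R^-1; nra.
by rewrite mxE eqxx mulr1 divr_ge0 ?(ltW n_gt0)//; lra.
Qed.

(** The unit matrix [F = J / n] separates: [<F, P> >= 0] on the cone, while
    [<F, X> = - (n - 2) / n] at the extremal matrix. *)
Lemma extremal_dist_ge P : PSD P -> (n%:R - 2) / n%:R <= frob (extremal_mx - P).
Proof.
move=> pP; pose e : 'cV[R]_n := const_mx 1.
pose E := e *m e^T; pose F : 'M[R]_n := n%:R^-1 *: E.
have EE i j : E i j = 1 by rewrite !mxE big_ord1 !mxE mulr1.
have FE i j : F i j = n%:R^-1 by rewrite mxE EE mulr1.
have FF : mxdot F F = 1.
  rewrite /mxdot; under eq_bigr do under eq_bigr do rewrite FE.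
  rewrite !sumr_const card_ord -mulrnA -[LHS]mulr_natr natrM.
  by field; rewrite gt_eqF.
have F0 : 0 <= mxdot F P.
  by rewrite mxdotC mxdotZr mulr_ge0 ?invr_ge0 ?(ltW n_gt0)// PSD_dot.
have FX : mxdot F extremal_mx = - ((n%:R - 2) / n%:R).
  rewrite /mxdot (eq_bigr (fun=> n%:R^-1 * (2 / n%:R - 1))).
    by rewrite sumr_const card_ord -[LHS]mulr_natr; field; rewrite gt_eqF.
  move=> i _; rewrite (bigD1 i)//= FE mxE eqxx mulr1.
  rewrite (eq_bigr (fun=> - n%:R^-1 ^+ 2)); last first.
    move=> j ji; rewrite FE mxE eq_sym (negPf ji) mulr0; ring.
  rewrite sumr_const cardC1 card_ord -[_ *+ n.-1]mulr_natr.
  have -> : n.-1%:R = n%:R - 1 :> R.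
    by rewrite -[in RHS](prednK (ltnW n_ge2)) -natr1 addrK.
  by field; rewrite gt_eqF.
rewrite -frobN opprB (le_trans _ (mxdot_unit_le_frob _ _ FF))//.
by rewrite mxdotBr FX opprK lerDr.
Qed.

End Bounds.

Theorem theorem2 (R : realType) (n : nat) (hn : (2 <= n)%N) :
  dist_tr (@SDDdual R n) = ((n%:R - 2) / n%:R)%:E.
Proof.
apply/eqP; rewrite eq_le; apply/andP; split.
  apply: ge_ereal_sup => _ [X [sX trX] <-].
  by rewrite lee_fin; exact: SDDdual_dist_le.
apply: ereal_sup_ge; exists (frob (extremal_mx - proj_PSD (@extremal_mx R n)))%:E.
  exists extremal_mx => //; split; last exact: mxtrace_extremal.
  exact: SDDdual_extremal.
rewrite lee_fin; apply: extremal_dist_ge => //.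
by have [] := proj_PSDP (@extremal_mx R n).
Qed.
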